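(* Let $\Delta$ be a finite set of conditional domain constraints (CDCs) and functional dependencies (FDs) over $R$. Then the FDs are $\emptyset$-separable in $\Delta$ from the CDCs; that is, every horizontal decomposition of $R$ is lossless under $\Delta$ if and only if it is lossless under $\mathrm{cdc}(\Delta)$.
   Context: Setting. $\mathbf{dom}$ is a (possibly infinite) set of values; $\mathbf{idom}$ is a set of values from a specific interpreted domain (e.g. $\mathbb Z$) on which predicates and functions are defined according to a first-order language $\mathfrak C$ closed under negation. $R$ is a relation symbol of arity $n$ whose first $k$ positions are non-interpreted (values from $\mathbf{dom}$) and whose remaining $n-k$ positions are interpreted (values from $\mathbf{idom}$). Variables $\overline x=(x_1,\dots,x_k)$ refer to non-interpreted positions, $\overline y=(y_1,\dots,y_{n-k})$ to interpreted ones ($y_i$ refers to position $k+i$). $\mathfrak C$-formulae have free variables among $\overline y$. All instances (associating relation symbols with subsets of $\mathbf{dom}^k\times\mathbf{idom}^{n-k}$) are finite; entailment $\models$ is with respect to finite instances. A CDC is a formula $\forall\overline x,\overline y.\,(R(\overline x,\overline y)\land\lambda(\overline x))\to\delta(\overline y)$, where $\lambda$ is a Boolean combination of equalities $x_i=a$ with $a\in\mathbf{dom}$ (possibly $\top$) and $\delta(\overline y)\in\mathfrak C$. A horizontal decomposition $\Sigma$ is a finite set of view definitions, one for each view symbol $V_1,\dots,V_m$ (each of the same arity and position types as $R$), of the form $\forall\overline x,\overline y.\,V_i(\overline x,\overline y)\leftrightarrow(R(\overline x,\overline y)\land\lambda_i(\overline x)\land\sigma_i(\overline y))$, with $\lambda_i$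 a Boolean combination of equalities as for CDCs (possibly $\top$) and $\sigma_i\in\mathfrak C$; the conjunct $\sigma_i$ may be absent. $\Sigma$ is lossless under a set $\Gamma$ of constraints over $R$ if $\Gamma\cup\Sigma\models\forall\overline x,\overline y.\,R(\overline x,\overline y)\leftrightarrow\bigvee_iV_i(\overline x,\overline y)$. $\mathrm{cdc}(\Delta)$ is the set of all CDCs in $\Delta$. Separability: for a finite set $\mathcal S$ of sound inference rules, the constraints in $\Delta$ other than CDCs are $\mathcal S$-separable in $\Delta$ from the CDCs if every horizontal decomposition is lossless under $\Delta$ exactly when it is lossless under $\mathrm{cdc}(\Delta^* )$, where $\Delta^*$ is the closure of $\Delta$ under the rules in $\mathcal S$ (so $\Delta^*=\Delta$ for $\mathcal S=\emptyset$). *)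

(* Defs.v *)
From mathcomp Require Import all_boot.
From mathcomp Require Import boolp classical_sets functions cardinality.

Set Implicit Arguments.
Unset Strict Implicit.
Unset Printing Implicit Defensive.

Local Open Scope classical_set_scope.

(* The relation symbol R has arity n = k + l: positions 0 .. k-1 are          *)
(* non-interpreted (values in dom), positions k .. k+l-1 are interpreted      *)
(* (values in idom).                                                          *)

(* First-order formulae are well scoped: the free variables of               *)
(* [phi : formula L m] are among the m variables indexed by 'I_m.             *)

Record signature : Type := Signature {
  fsym : Type; farity : fsym -> nat;
  psym : Type; parity : psym -> nat }.

Inductive term (L : signature) (m : nat) : Type :=
| tvar of 'I_m
| tapp (f : fsym L) of ('I_(farity f) -> term L m).

Inductive formula (L : signature) : nat -> Type :=
| ffalse m : formula L m
| feq m of term L m & term L m : formula L m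
| fpred m (p : psym L) of ('I_(parity p) -> term L m) : formula L m
| fnot m of formula L m : formula L m
| fand m of formula L m & formula L m : formula L m
| for_ m of formula L m & formula L m : formula L m
| fall m of formula L m.+1 : formula L m
| fex m of formula L m.+1 : formula L m.

Record structure (L : signature) (idom : Type) : Type := Structure {
  finterp : forall f : fsym L, ('I_(farity f) -> idom) -> idom;
  pinterp : forall p : psym L, ('I_(parity p) -> idom) -> Prop }.

Fixpoint teval (L : signature) (idom : Type) (M : structure L idom) (m : nat)
    (v : 'I_m -> idom) (t : term L m) : idom :=
  match t with
  | tvar i => v i
  | tapp f ts => finterp M (fun i => teval M v (ts i))
  end.

(* The variable bound by a quantifier is index 0 of its body. *)
Definition extend (idom : Type) (m : nat) (v : 'I_m -> idom) (a : idom) :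
    'I_m.+1 -> idom :=
  fun i => oapp v a (unlift ord0 i).

Fixpoint feval (L : signature) (idom : Type) (M : structure L idom) (m : nat)
    (phi : formula L m) : ('I_m -> idom) -> Prop :=
  match phi in formula _ m return ('I_m -> idom) -> Prop with
  | ffalse _ => fun=> False
  | feq _ t u => fun v => teval M v t = teval M v u
  | fpred _ p ts => fun v => pinterp M (fun i => teval M v (ts i))
  | fnot _ phi => fun v => ~ feval M phi v
  | fand _ phi psi => fun v => feval M phi v /\ feval M psi v
  | for_ _ phi psi => fun v => feval M phi v \/ feval M psi v
  | fall _ phi => fun v => forall a, feval M phi (extend v a)
  | fex _ phi => fun v => exists a, feval M phi (extend v a)
  end.

(* The constraint language may be a proper fragment of the first-order       *)
(* formulae (e.g. two-variable inequalities over the integers), so closure    *)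
(* under negation is up to equivalence in M; syntactic closure is a special   *)
(* case.                                                                      *)
Record language (L : signature) (idom : Type) (M : structure L idom)
    (l : nat) : Type := Language {
  in_language : set (formula L l);
  language_neg : forall phi, in_language phi ->
    exists2 psi, in_language psi & forall v, feval M psi v <-> ~ feval M phi v }.

Inductive boolcomb (dom : Type) (k : nat) : Type :=
| btrue
| beq of 'I_k & dom
| bnot of boolcomb dom k
| band of boolcomb dom k & boolcomb dom k
| bor of boolcomb dom k & boolcomb dom k.

Fixpoint beval (dom : Type) (k : nat) (b : boolcomb dom k) (x : k.-tuple dom) :
    Prop :=
  match b with
  | btrue => True
  | beq i a => tnth x i = a
  | bnot b => ~ beval b x
  | band b c => beval b x /\ beval c x
  | bor b c => beval b x \/ beval c x
  end.

Section Constraints.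
Variables (dom idom : Type) (L : signature) (M : structure L idom) (k l : nat).
Variable C : language M l.

Definition row : Type := (k.-tuple dom * l.-tuple idom)%type.

(* [CDC lambda delta _] is  R(x, y) /\ lambda(x) -> delta(y);
   [FD X Y] is the functional dependency X -> Y, on arbitrary positions. *)
Inductive constraint : Type :=
| CDC (lambda : boolcomb dom k) (delta : formula L l) of in_language C delta
| FD of {set 'I_(k + l)} & {set 'I_(k + l)}.

Definition agree_at (t u : row) (j : 'I_(k + l)) : Prop :=
  match fintype.split j with
  | inl i => tnth t.1 i = tnth u.1 i
  | inr i => tnth t.2 i = tnth u.2 i
  end.

Definition agree_on (X : {set 'I_(k + l)}) (t u : row) : Prop :=
  forall j, j \in X -> agree_at t u j.

Definition sat_constraint (r : set row) (c : constraint) : Prop :=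
  match c with
  | CDC lambda delta _ =>
      forall x y, r (x, y) /\ beval lambda x -> feval M delta (tnth y)
  | FD X Y =>
      forall t u, r t -> r u -> agree_on X t u -> agree_on Y t u
  end.

Definition is_cdc (c : constraint) : Prop :=
  if c is CDC _ _ _ then True else False.

Definition cdc (Delta : set constraint) : set constraint :=
  [set c | Delta c /\ is_cdc c].

(* [view_sigma = None] encodes an absent conjunct sigma. *)
Record view : Type := View {
  view_lambda : boolcomb dom k;
  view_sigma : option (formula L l);
  view_sigmaP : forall s, view_sigma = Some s -> in_language C s }.

Definition decomposition (m : nat) : Type := 'I_m -> view.

Record instance (m : nat) : Type := Instance {
  rel_R : set row;
  rel_V : 'I_m -> set row;
  fin_R : finite_set rel_R;
  fin_V : forall i, finite_set (rel_V i) }.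

Definition sat_view (m : nat) (I : instance m) (i : 'I_m) (d : view) : Prop :=
  forall x y, rel_V I i (x, y) <->
    [/\ rel_R I (x, y), beval (view_lambda d) x
      & if view_sigma d is Some s then feval M s (tnth y) else True].

Definition lossless (Gamma : set constraint) (m : nat)
    (Sigma : decomposition m) : Prop :=
  forall I : instance m,
    (forall c, Gamma c -> sat_constraint (rel_R I) c) ->
    (forall i, sat_view I i (Sigma i)) ->
    forall x y, rel_R I (x, y) <-> exists i, rel_V I i (x, y).

(* [rule_inst r P c]: some instance of r derives c from the premises P. *)
Record rule : Type := Rule {
  rule_inst : set constraint -> constraint -> Prop;
  rule_fin : forall P c, rule_inst P c -> finite_set P;
  rule_sound : forall P c, rule_inst P c ->
    forall r : set row, finite_set r ->
      (forall p, P p -> sat_constraint r p) -> sat_constraint r c }.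

Inductive closure (S : set rule) (Delta : set constraint) : constraint -> Prop :=
| closure_base c : Delta c -> closure S Delta c
| closure_rule r P c : S r -> rule_inst r P c ->
    (forall p, P p -> closure S Delta p) -> closure S Delta c.

Lemma closure0 (Delta : set constraint) : closure set0 Delta = Delta.
Proof.
by apply/seteqP; split=> [c [//|? ? ? []]|c]; exact: closure_base.
Qed.

(* Used for finite S. As every constraint here is a CDC or an FD, this is the
   S-separability of the FDs in Delta from the CDCs. *)
Definition separable (S : set rule) (Delta : set constraint) : Prop :=
  forall (m : nat) (Sigma : decomposition m),
    lossless Delta Sigma <-> lossless (cdc (closure S Delta)) Sigma.

End Constraints.

(* Main.v *)
(* A tuple t of R missed by all views is still missed after R is shrunk to {t}
   and the views are intersected with {t}. Shrinking preserves the CDCs, which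
   are universal, and a singleton satisfies every FD, so a counterexample under
   the CDCs alone yields one under Delta. *)

Require Import Defs.
From mathcomp Require Import all_boot.
From mathcomp Require Import boolp classical_sets functions cardinality.

Set Implicit Arguments.
Unset Strict Implicit.
Unset Printing Implicit Defensive.

Local Open Scope classical_set_scope.

Section Restriction.
Variables (dom idom : Type) (L : signature) (M : structure L idom) (k l : nat).
Variable C : language M l.

Lemma sat_cdc_subset (r s : set (row dom idom k l)) (c : constraint dom k C) :
  is_cdc c -> s `<=` r -> sat_constraint r c -> sat_constraint s c.
Proof. by case: c => //= la de Cde _ sr rc x y [/sr rxy lax]; apply: (rc x y). Qed.

Lemma sat_fd1 (t : row dom idom k l) (X Y : {set 'I_(k + l)}) :
  sat_constraint [set t] (FD dom C X Y).
Proof.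
by move=> _ _ -> -> _ j _; rewrite /agree_at; case: fintype.split.
Qed.

Lemma finite_rel_VI m (I : instance dom idom k l m) (A : set (row dom idom k l))
    (i : 'I_m) :
  finite_set (rel_V I i `&` A).
Proof. exact: finite_setIl (fin_V I i). Qed.

(** The views are cut down by intersection instead of being recomputed from [R], so their finiteness
    is inherited from [I]. *)
Definition restrict1 m (I : instance dom idom k l m) (t : row dom idom k l) :=
  Instance (finite_set1 t) (@finite_rel_VI m I [set t]).

(** A view definition speaks of one tuple at a time, so it survives intersecting both sides with
    [[set t]]; [rel_R I t] makes the new [R] such an intersection. *)
Lemma sat_view_restrict1 m (I : instance dom idom k l m) t i (d : view dom k C) :
  rel_R I t -> sat_view I i d -> sat_view (restrict1 I t) i d.
Proof.
move=> Rt Id x y; split=> /=.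
  by case=> /Id[_ lax sy] xyt.
by case=> xyt lax sy; split=> //; apply/Id; split=> //; rewrite xyt.
Qed.

Lemma lossless_sub (Gamma Delta : set (constraint dom k C)) m
    (Sigma : decomposition dom k C m) :
  Gamma `<=` Delta -> lossless Gamma Sigma -> lossless Delta Sigma.
Proof. by move=> GD GS I ID; apply: GS => c /GD; exact: ID. Qed.

Lemma lossless_cdc (Delta : set (constraint dom k C)) m
    (Sigma : decomposition dom k C m) :
  lossless Delta Sigma -> lossless (cdc Delta) Sigma.
Proof.
(* Each view lies inside [R] by its definition; only the other inclusion uses [DS]. *)
move=> DS I Icdc IS x y; split; last by case=> i /IS[].
move=> Rxy.
have sat1 c : Delta c -> sat_constraint (rel_R (restrict1 I (x, y))) c.
  case: c => [la de Cde|X Y] Dc; last exact: sat_fd1.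
  have sub : [set (x, y)] `<=` rel_R I by move=> _ ->.
  by apply: sat_cdc_subset sub _ => //; exact: Icdc.
have view1 i : sat_view (restrict1 I (x, y)) i (Sigma i).
  exact: sat_view_restrict1.
(* The restricted view that contains [(x, y)] is a subset of the original one, so the same index
   serves for [I]. *)
have /(DS _ sat1 view1)[i [Vi _]] : rel_R (restrict1 I (x, y)) (x, y) by [].
by exists i.
Qed.

End Restriction.

Theorem theorem5 (dom idom : Type) (L : signature) (M : structure L idom)
    (k l : nat) (C : language M l) (Delta : set (constraint dom k C))
    (finDelta : finite_set Delta) :
  separable set0 Delta.
Proof.
move=> m Sigma; rewrite closure0; split; first exact: lossless_cdc.
by apply: lossless_sub => c [].
Qed.
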